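(* Let $K$ be a field with a positive definite involution, $X$ an infinite totally disconnected compact metrizable space, $T:X\to X$ a homeomorphism, $\mu$ a $T$-invariant, ergodic, full probability measure on $X$, and $\mathcal{A}=C_K(X)\rtimes_T\mathbb{Z}$. Let $E\subseteq X$ be a non-empty clopen subset, $\mathcal{P}$ a finite partition of $X\setminus E$ into clopen subsets, and $\mathcal{B}=\mathcal{A}(E,\mathcal{P})$ the unital $*$-subalgebra of $\mathcal{A}$ generated by $\{\chi_Zt\mid Z\in\mathcal{P}\}$. With $\mathbb{V}$ and $\pi$ as defined in the context, for every $k\ge 1$ and every $A\in M_k(\mathcal{B})$, $$b^{\mathcal{A}}(A)=\sum_{W\in\mathbb{V}}\mu(W)\,\dim_K(\ker\pi(A)_W),$$ where $\dim_K$ is the usual dimension of finite-dimensional $K$-vector spaces.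
   Context: A positive definite involution on $K$ is an involution $*$ such that for all $r\ge1$, $\sum_{i=1}^ra_i^*a_i=0$ implies all $a_i=0$. A measure is full if every non-empty open set has positive measure. $C_K(X)$ is the algebra of locally constant functions $X\to K$; $\chi_U$ is the characteristic function of $U$; $t$ is the canonical unitary of the crossed product $*$-algebra $\mathcal{A}$, with $t\chi_Ut^{-1}=\chi_{T(U)}$ for $U$ clopen. Rank function. A Sylvester matrix rank function on a unital ring $R$ is a map $\mathrm{rk}$ from finite matrices over $R$ to $\mathbb{R}_{\ge0}$ with $\mathrm{rk}(0)=0$, $\mathrm{rk}(1)=1$; $\mathrm{rk}(M_1M_2)\le\min\{\mathrm{rk}(M_1),\mathrm{rk}(M_2)\}$; $\mathrm{rk}\begin{pmatrix}M_1&0\\0&M_2\end{pmatrix}=\mathrm{rk}(M_1)+\mathrm{rk}(M_2)$; $\mathrm{rk}\begin{pmatrix}M_1&M_3\\0&M_2\end{pmatrix}\ge\mathrm{rk}(M_1)+\mathrm{rk}(M_2)$. It is a known fact (taken as given) that there is a unique Sylvester matrix rank function $\mathrm{rk}_{\mathcal{A}}$ on $\mathcal{A}$ with $\mathrm{rk}_{\mathcal{A}}(\chi_U)=\mu(U)$ for every clopen $U\subseteq X$. For $A\in M_k(\mathcal{A})$ the $\mathcal{A}$-Betti number of $A$ is $b^{\mathcal{A}}(A)=k-\mathrm{rk}_{\mathcal{A}}(A)$. The set $\mathbb{V}$ and representation $\pi$. $\mathbb{V}$ is the set of all non-empty subsets of $X$ of the form $$W=E\cap T^{-1}(Z_1)\cap\cdots\cap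 T^{-l+1}(Z_{l-1})\cap T^{-l}(E),\qquad l\ge 1,\ Z_1,\dots,Z_{l-1}\in\mathcal{P},$$ and for such $W$ its length is $|W|=l$. For $W\in\mathbb{V}$ the elements $e_{ij}(W)=(\chi_{X\setminus E}t)^i\chi_W(t^{-1}\chi_{X\setminus E})^j$, $0\le i,j<|W|$, form a system of $|W|\times|W|$ matrix units in $\mathcal{B}$; the element $h_W=\sum_{i=0}^{|W|-1}e_{ii}(W)$ is a central projection of $\mathcal{B}$, and $h_W\mathcal{B}\cong M_{|W|}(K)$ via these matrix units. The map $\pi:\mathcal{B}\to\prod_{W\in\mathbb{V}}M_{|W|}(K)$, $\pi(a)=(h_Wa)_W$, is an injective $*$-homomorphism; it is extended entrywise to $\pi:M_k(\mathcal{B})\to\prod_{W\in\mathbb{V}}M_k(K)\otimes M_{|W|}(K)=\prod_{W\in\mathbb V}M_{k|W|}(K)$, and $\pi(A)_W\in M_{k|W|}(K)$ denotes the $W$-component, acting on $K^{k|W|}$ by left multiplication. *)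

(* Defs.v *)
From HB Require Import structures.
From mathcomp Require Import all_boot all_order all_algebra.
From mathcomp Require Import finmap zify ring.
From mathcomp Require Import all_classical all_reals all_analysis.

Set Implicit Arguments.
Unset Strict Implicit.
Unset Printing Implicit Defensive.
Import Order.TTheory GRing.Theory Num.Theory.

Local Open Scope classical_set_scope.
Local Open Scope ring_scope.

Definition metrizable (R : realType) (X : topologicalType) : Prop :=
  exists d : X -> X -> R,
    [/\ forall x, d x x = 0,
        forall x y, d x y = 0 -> x = y,
        forall x y, d x y = d y x,
        forall x y z, d x z <= d x y + d y z
      & forall x : X,
          nbhs x = filter_from [set e : R | 0 < e]
                               (fun e => [set y | d x y < e])].

Record homeo (X : topologicalType) := Homeo {
  hfun :> X -> X;
  hinv : X -> X;
  hfunK : cancel hfun hinv;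
  hinvK : cancel hinv hfun;
  hfun_cont : continuous hfun;
  hinv_cont : continuous hinv }.

(* T^n for n : int *)
Definition hpow (X : topologicalType) (T : homeo X) (n : int) : X -> X :=
  match n with
  | Posz m => iter m T
  | Negz m => iter m.+1 (hinv T)
  end.

Section HomeoPowers.
Variables (X : topologicalType) (T : homeo X).

Lemma hpow0 x : hpow T 0 x = x. Proof. by []. Qed.

Lemma hpow1 x : hpow T 1 x = T x. Proof. by []. Qed.

Lemma hpowN1 x : hpow T (-1) x = hinv T x. Proof. by []. Qed.

Lemma hpowS (n : int) x : hpow T (n + 1) x = T (hpow T n x).
Proof.
case: n => [m|m]; first by rewrite -PoszD addn1.
case: m => [|m]; first by rewrite /= hinvK.
by rewrite (_ : Negz m.+1 + 1 = Negz m) ?[RHS]hinvK // !NegzE; lia.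
Qed.

Lemma hpowP (n : int) x : hpow T (n - 1) x = hinv T (hpow T n x).
Proof. by rewrite -[n in RHS](subrK 1) hpowS hfunK. Qed.

Lemma hpowD (m n : int) x : hpow T (m + n) x = hpow T m (hpow T n x).
Proof.
elim/int_rect: m => [|m IH|m IH]; first by rewrite add0r.
  by rewrite -addn1 PoszD addrAC !hpowS IH.
by rewrite -addn1 PoszD opprD addrAC !hpowP IH.
Qed.

Lemma iter_cont (f : X -> X) m : continuous f -> continuous (iter m f).
Proof.
move=> cf; elim: m => [|m IH] x; first exact: cvg_id.
by apply: (@continuous_comp _ _ _ (iter m f) f); [exact: IH|exact: cf].
Qed.

Lemma hpow_cont (n : int) : continuous (hpow T n).
Proof.
by case: n => m; apply: iter_cont; [exact: hfun_cont|exact: hinv_cont].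
Qed.

End HomeoPowers.

(* C_K(X) *)
Definition locally_constant (X : ptopologicalType) (K : fieldType) :
    {pred X -> K} :=
  fun f => `[< forall x : X, \forall y \near x, f y = f x >].

Section LocallyConstant.
Variables (X : ptopologicalType) (K : fieldType).
Local Notation lc := (@locally_constant X K).

Lemma locally_constant_subring : subring_closed lc.
Proof.
split=> [|f g /asboolP lf /asboolP lg|f g /asboolP lf /asboolP lg].
- by apply/asboolP => x; apply: nearW.
- apply/asboolP => x; have fx := lf x; have gx := lg x.
  by near=> y; rewrite /GRing.add /GRing.opp /=; congr (_ - _); near: y.
- apply/asboolP => x; have fx := lf x; have gx := lg x.
  by near=> y; rewrite /GRing.mul /=; congr (_ * _); near: y.
Unshelve. all: by end_near. Qed.

HB.instance Definition _ :=
  GRing.isSubringClosed.Build (X -> K) lc locally_constant_subring.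

Record lcfun := LCFun { lcval :> X -> K; lcvalP : lcval \in lc }.
HB.instance Definition _ := [isSub for lcval].
HB.instance Definition _ := [Choice of lcfun by <:].
HB.instance Definition _ := [SubChoice_isSubComNzRing of lcfun by <:].

Lemma lcfunP (f g : lcfun) : (forall x, f x = g x) -> f = g.
Proof. by move=> fg; apply/val_inj/funext. Qed.

Lemma lcfunD (f g : lcfun) x : (f + g) x = f x + g x. Proof. by []. Qed.
Lemma lcfunM (f g : lcfun) x : (f * g) x = f x * g x. Proof. by []. Qed.
Lemma lcfun0 x : (0 : lcfun) x = 0. Proof. by []. Qed.
Lemma lcfun1 x : (1 : lcfun) x = 1. Proof. by []. Qed.

Lemma lc_cst_subproof (c : K) : (fun=> c) \in lc.
Proof. by apply/asboolP => x; apply: nearW. Qed.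
Definition lc_cst (c : K) : lcfun := LCFun (lc_cst_subproof c).

Lemma lc_map_subproof (h : K -> K) (f : lcfun) : (h \o f) \in lc.
Proof.
apply/asboolP => x; have /asboolP/(_ x) fx := lcvalP f.
by near=> y => /=; congr (h _); near: y.
Unshelve. all: by end_near. Qed.
Definition lc_map (h : K -> K) (f : lcfun) : lcfun :=
  LCFun (lc_map_subproof h f).

Lemma lc_shift_subproof (T : homeo X) (n : int) (f : lcfun) :
  (f \o hpow T (- n)) \in lc.
Proof.
apply/asboolP => x; have /asboolP/(_ (hpow T (- n) x)) fx := lcvalP f.
exact: (hpow_cont fx).
Qed.
(* t^n f t^(-n) = f \o T^(-n) *)
Definition lc_shift (T : homeo X) (n : int) (f : lcfun) : lcfun :=
  LCFun (lc_shift_subproof T n f).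

(* Characteristic function of U; it lies in C_K(X) exactly when U is clopen,
   and chi U is the junk value 0 otherwise. *)
Definition chi (U : set X) : lcfun := insubd 0 (\1_U : X -> K).

Lemma chiE (U : set X) x : clopen U -> chi U x = \1_U x.
Proof.
move=> [oU cU]; rewrite /chi.
suff H : (\1_U : X -> K) \in lc by rewrite -[LHS]/(val _ x) insubdK.
apply/asboolP => y; rewrite /indic; have [Uy|nUy] := pselect (U y).
  have Uy' : nbhs y U by exact: open_nbhs_nbhs.
  by near=> z; rewrite !mem_set //; near: z.
have Uy' : nbhs y (~` U) by apply: open_nbhs_nbhs; split=> //; exact: closed_openC.
by near=> z; rewrite !memNset //; near: z.
Unshelve. all: by end_near. Qed.

End LocallyConstant.

Section FiniteSupport.
Variables (X : ptopologicalType) (K : fieldType).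
Local Notation C := (lcfun X K).

Definition finitely_supported : {pred int -> C} :=
  fun a => `[< finite_set [set n | a n != 0] >].

Lemma finitely_supportedP (a : int -> C) :
  reflect (exists s : {fset int}, forall n, n \notin s -> a n = 0)
          (a \in finitely_supported).
Proof.
apply: (iffP (asboolP _)) => [/finite_fsetP[s Es]|[s sP]].
  exists s => n ns; apply/eqP; apply: contraNT ns => an0.
  by have : [set n | a n != 0] n by []; rewrite Es.
apply: (finite_subfset s) => n /=; apply: contraR => ns.
by rewrite sP.
Qed.

Lemma finitely_supported_zmod : zmod_closed finitely_supported.
Proof.
split=> [|a b /finitely_supportedP[s sP] /finitely_supportedP[r rP]].
  by apply/finitely_supportedP; exists fset0.
apply/finitely_supportedP; exists (s `|` r)%fset => n.
rewrite inE negb_or => /andP[ns nr].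
by rewrite -[LHS]/(a n - b n) sP // rP // subr0.
Qed.

HB.instance Definition _ :=
  GRing.isZmodClosed.Build (int -> C) finitely_supported
    finitely_supported_zmod.

End FiniteSupport.

(* The crossed product C_K(X) x_T Z, with a : crossed standing for
   \sum_n (a n) t^n; the parameter T is what selects the product. *)
Record crossed (X : ptopologicalType) (K : fieldType) (T : homeo X) :=
  Crossed { crval :> int -> lcfun X K; crvalP : crval \in @finitely_supported X K }.
Arguments crossed {X} K T.

Section Crossed.
Variables (X : ptopologicalType) (K : fieldType) (T : homeo X).
Local Notation C := (lcfun X K).
Local Notation sh := (lc_shift T).
Local Notation fs := (@finitely_supported X K).

Lemma lc_shift0 (f : C) : sh 0 f = f.
Proof. exact: lcfunP. Qed.

Lemma lc_shift_comp (m n : int) (f : C) : sh m (sh n f) = sh (m + n) f.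
Proof. by apply: lcfunP => x /=; rewrite -hpowD -opprD addrC. Qed.

Lemma lc_shift_is_zmod n : zmod_morphism (sh n : C -> C).
Proof. by move=> f g; apply: lcfunP. Qed.
Lemma lc_shift_is_monoid n : monoid_morphism (sh n : C -> C).
Proof. by split=> [|f g]; apply: lcfunP. Qed.
HB.instance Definition _ n :=
  GRing.isZmodMorphism.Build C C (lc_shift T n) (lc_shift_is_zmod n).
HB.instance Definition _ n :=
  GRing.isMonoidMorphism.Build C C (lc_shift T n) (lc_shift_is_monoid n).

HB.instance Definition _ := [isSub for @crval X K T].
HB.instance Definition _ := [Choice of crossed K T by <:].
HB.instance Definition _ := [SubChoice_isSubZmodule of crossed K T by <:].

Implicit Types a b c : crossed K T.

Lemma crossedP a b : (forall n, a n = b n) -> a = b.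
Proof. by move=> ab; apply/val_inj/funext. Qed.

Lemma cr0E n : (0 : crossed K T) n = 0. Proof. by []. Qed.
Lemma crDE a b n : (a + b) n = a n + b n. Proof. by []. Qed.
Lemma crNE a n : (- a) n = - a n. Proof. by []. Qed.

Lemma crossed_supp a :
  exists s : {fset int}, forall n, n \notin s -> a n = 0.
Proof. exact/finitely_supportedP/crvalP. Qed.

(* (\sum_i (a i) t^i) (\sum_j (b j) t^j)
   = \sum_i \sum_j (a i) (b j \o T^(-i)) t^(i + j) *)
Definition cr_mul_fun (a b : int -> C) (n : int) : C :=
  \sum_(i \in [set: int]) a i * sh i (b (n - i)).

Lemma cr_mul_funE (s : {fset int}) (a b : int -> C) n :
  (forall i, i \notin s -> a i = 0) ->
  cr_mul_fun a b n = \sum_(i <- s) a i * sh i (b (n - i)).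
Proof.
by move=> sP; apply: fsbigTE => i /sP ->; rewrite mul0r.
Qed.

Lemma cr_mul_supp (s r : {fset int}) a b :
  (forall n, n \notin s -> a n = 0) -> (forall n, n \notin r -> b n = 0) ->
  forall n, n \notin [fset (i + j)%R | i in s, j in r]%fset -> cr_mul_fun a b n = 0.
Proof.
move=> sP rP n nsr; rewrite (cr_mul_funE _ _ sP) big_seq big1 // => i si.
rewrite rP ?raddf0 ?mulr0 //; apply: contraNN nsr => ri.
by apply/imfset2P; exists i => //; exists (n - i) => //=; rewrite addrC subrK.
Qed.

Lemma cr_mul_subproof a b : cr_mul_fun a b \in fs.
Proof.
have [s sP] := crossed_supp a; have [r rP] := crossed_supp b.
apply/finitely_supportedP; eexists; exact: cr_mul_supp sP rP.
Qed.
Definition cr_mul a b : crossed K T := @Crossed X K T _ (cr_mul_subproof a b).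

Lemma cr_mono_subproof (n : int) (f : C) :
  (fun m => if m == n then f else 0) \in fs.
Proof.
apply/finitely_supportedP; exists [fset n]%fset => m.
by rewrite inE => /negPf ->.
Qed.
(* f t^n *)
Definition cr_mono (n : int) (f : C) : crossed K T :=
  @Crossed X K T _ (cr_mono_subproof n f).

Lemma cr_mono_supp n f m : m \notin [fset n]%fset -> cr_mono n f m = 0.
Proof. by rewrite inE /= => /negPf ->. Qed.

Lemma cr_mulA : associative cr_mul.
Proof.
move=> a b c; apply: crossedP => n.
have [s sP] := crossed_supp a; have [r rP] := crossed_supp b.
rewrite [LHS](cr_mul_funE _ _ sP) [RHS](cr_mul_funE _ _ (cr_mul_supp sP rP)).
under [RHS]eq_bigr => j _ do rewrite (cr_mul_funE _ _ sP) mulr_suml.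
rewrite exchange_big /= !big_seq; apply: eq_bigr => i si.
rewrite [cr_mul_fun _ _ _](cr_mul_funE _ _ rP) raddf_sum mulr_sumr.
pose G k := a i * (sh i (b k) * sh (i + k) (c (n - i - k))).
transitivity (\sum_(k <- r) G k).
  by apply: eq_bigr => k _; rewrite /= rmorphM /= lc_shift_comp.
transitivity (\sum_(j <- [fset (i + j)%R | i in s, j in r]%fset) G (j - i)); last first.
  apply: eq_bigr => j _; rewrite /G -mulrA; congr (_ * (_ * _)).
  by congr (lc_shift _ _ (c _)); ring.
have G0 k : k \notin r -> G k = 0.
  by move=> kr; rewrite /G rP // raddf0 mul0r mulr0.
rewrite -(fsbigTE r G) // -(fsbigTE _ (fun j => G (j - i))); last first.
  move=> j jsr; apply: G0; apply: contraNN jsr => jr.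
  by apply/imfset2P; exists i => //; exists (j - i) => //=; rewrite addrC subrK.
apply: reindex_fsbigT; exists (fun k => k + i) => k; first exact: subrK.
exact: addrK.
Qed.

Lemma cr_mul1 : left_id (cr_mono 0 1) cr_mul.
Proof.
move=> a; apply: crossedP => n.
rewrite [LHS](cr_mul_funE _ _ (@cr_mono_supp 0 1)) big_seq_fset1 /=.
by rewrite mul1r subr0 lc_shift0.
Qed.

Lemma cr_mulr1 : right_id (cr_mono 0 1) cr_mul.
Proof.
move=> a; apply: crossedP => n.
rewrite [LHS](fsbigTE [fset n]%fset) => [|i]; last first.
  by rewrite inE /= subr_eq0 eq_sym => /negPf ->; rewrite raddf0 mulr0.
by rewrite big_seq_fset1 subrr /= rmorph1 mulr1.
Qed.

Lemma cr_mulDl : left_distributive cr_mul +%R.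
Proof.
move=> a b c; apply: crossedP => n.
have [s sP] := crossed_supp a; have [r rP] := crossed_supp b.
have sP' i : i \notin (s `|` r)%fset -> a i = 0.
  by rewrite inE negb_or => /andP[/sP].
have rP' i : i \notin (s `|` r)%fset -> b i = 0.
  by rewrite inE negb_or => /andP[_ /rP].
have abP i : i \notin (s `|` r)%fset -> (a + b) i = 0.
  by move=> isr; rewrite crDE sP' // rP' // addr0.
rewrite crDE [LHS](cr_mul_funE _ _ abP) [X in _ = X + _](cr_mul_funE _ _ sP').
rewrite [X in _ = _ + X](cr_mul_funE _ _ rP') -big_split /=.
by apply: eq_bigr => i _; rewrite -mulrDl.
Qed.

Lemma cr_mulDr : right_distributive cr_mul +%R.
Proof.
move=> a b c; apply: crossedP => n; have [s sP] := crossed_supp a.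
rewrite crDE [LHS](cr_mul_funE _ _ sP) [X in _ = X + _](cr_mul_funE _ _ sP).
rewrite [X in _ = _ + X](cr_mul_funE _ _ sP) -big_split /=.
by apply: eq_bigr => i _; rewrite -mulrDr -raddfD.
Qed.

Lemma cr_1neq0 : cr_mono 0 1 != 0.
Proof.
apply/eqP => /(congr1 (fun a : crossed K T => a 0)) /eqP.
by rewrite oner_eq0.
Qed.

HB.instance Definition _ := GRing.Zmodule_isNzRing.Build (crossed K T)
  cr_mulA cr_mul1 cr_mulr1 cr_mulDl cr_mulDr cr_1neq0.

Definition cr_scale (x : K) a : crossed K T := cr_mono 0 (lc_cst X x) * a.

Lemma cr_scaleE x a n p : cr_scale x a n p = x * a n p.
Proof.
rewrite [cr_scale _ _ _](cr_mul_funE _ _ (@cr_mono_supp 0 _)) big_seq_fset1 /=.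
by rewrite subr0.
Qed.

Lemma cr_scaleA x y a : cr_scale x (cr_scale y a) = cr_scale (x * y) a.
Proof.
by apply: crossedP => n; apply: lcfunP => p; rewrite !cr_scaleE mulrA.
Qed.
Lemma cr_scale1 : left_id 1 cr_scale.
Proof.
by move=> a; apply: crossedP => n; apply: lcfunP => p; rewrite cr_scaleE mul1r.
Qed.
Lemma cr_scaleDr : right_distributive cr_scale +%R.
Proof. by move=> x a b; rewrite /cr_scale mulrDr. Qed.
Lemma cr_scaleDl a : {morph cr_scale^~ a : x y / x + y}.
Proof.
move=> x y; apply: crossedP => n; apply: lcfunP => p.
by rewrite crDE lcfunD !cr_scaleE mulrDl.
Qed.
HB.instance Definition _ := GRing.Zmodule_isLmodule.Build K (crossed K T)
  cr_scaleA cr_scale1 cr_scaleDr cr_scaleDl.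

Lemma cr_scaleAl (x : K) a b : x *: (a * b) = x *: a * b.
Proof. exact: mulrA. Qed.
HB.instance Definition _ := GRing.Lmodule_isLalgebra.Build K (crossed K T) cr_scaleAl.

Lemma cr_scaleAr (x : K) a b : x *: (a * b) = a * (x *: b).
Proof.
apply: crossedP => n; apply: lcfunP => p; have [s sP] := crossed_supp a.
rewrite [LHS]cr_scaleE [(a * b) n](cr_mul_funE _ _ sP).
rewrite [(a * _) n](cr_mul_funE _ _ sP).
elim/big_rec2: _ => [|i u v _ IH]; first by rewrite !lcfun0 mulr0.
by rewrite !lcfunD mulrDr IH !lcfunM /= cr_scaleE; congr (_ + _); ring.
Qed.
HB.instance Definition _ := GRing.Lalgebra_isAlgebra.Build K (crossed K T) cr_scaleAr.

(* (\sum_n (a n) t^n)^* = \sum_n t^(-n) (a n)^* *)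
Definition cr_star_fun (conj : {rmorphism K -> K}) (a : int -> C) (n : int) : C :=
  sh n (lc_map conj (a (- n))).

Lemma cr_star_subproof (conj : {rmorphism K -> K}) a :
  cr_star_fun conj a \in fs.
Proof.
have [s sP] := crossed_supp a; apply/finitely_supportedP.
exists [fset (- i)%R | i in s]%fset => n ns; apply: lcfunP => p /=.
rewrite sP ?lcfun0 ?rmorph0 //; apply: contraNN ns => ns.
by apply/imfsetP; exists (- n) => //=; rewrite opprK.
Qed.
Definition cr_star (conj : {rmorphism K -> K}) a : crossed K T :=
  @Crossed X K T _ (cr_star_subproof conj a).

Lemma cr_starK (conj : {rmorphism K -> K}) : involutive conj ->
  involutive (cr_star conj).
Proof.
move=> conjK a; apply: crossedP => n; apply: lcfunP => p /=.
by rewrite conjK -hpowD !opprK addrN.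
Qed.

Lemma cr_starM (conj : {rmorphism K -> K}) a b :
  cr_star conj (a * b) = cr_star conj b * cr_star conj a.
Proof.
apply: crossedP => n.
have [s sP] := crossed_supp a.
pose F j := cr_star conj b j * sh j (cr_star conj a (n - j)).
rewrite [RHS](reindex_fsbigT (fun i => n + i) F); last first.
  by exists (fun i => i - n) => i; rewrite ?addrK /= addrC ?addKr ?addrNK ?subrK.
have sP' i : i \notin s -> F (n + i) = 0.
  move=> si; apply: lcfunP => p; rewrite /F lcfunM /=.
  by rewrite opprB [n + i]addrC addrK sP // !lcfun0 rmorph0 mulr0.
rewrite (fsbigTE s _ sP'); apply: lcfunP => p /=.
rewrite (cr_mul_funE _ _ sP).
elim/big_rec2: _ => [|i u v _ IH]; first by rewrite !lcfun0 rmorph0.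
rewrite !lcfunD !lcfunM rmorphD IH rmorphM mulrC /=; congr (_ * _ + _).
  by rewrite -hpowD; congr (conj (b _ (hpow T _ p))); ring.
by rewrite -hpowD; congr (conj (a _ (hpow T _ p))); ring.
Qed.

Definition cr_C (f : C) : crossed K T := cr_mono 0 f.

Definition cr_t : crossed K T := cr_mono 1 1.
Definition cr_tV : crossed K T := cr_mono (-1) 1.

Lemma cr_monoM m n (f g : C) :
  cr_mono m f * cr_mono n g = cr_mono (m + n) (f * sh m g).
Proof.
apply: crossedP => p.
rewrite [LHS](cr_mul_funE _ _ (@cr_mono_supp m f)) big_seq_fset1 /= eqxx.
rewrite subr_eq [n + m]addrC.
by case: ifP => _ //; rewrite raddf0 mulr0.
Qed.

Lemma cr_ttV : cr_t * cr_tV = 1.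
Proof. by rewrite cr_monoM subrr mul1r rmorph1. Qed.

Lemma cr_tVt : cr_tV * cr_t = 1.
Proof. by rewrite cr_monoM addNr mul1r rmorph1. Qed.

Lemma cr_t_unitary (conj : {rmorphism K -> K}) : cr_star conj cr_t = cr_tV.
Proof.
apply: crossedP => n; apply: lcfunP => p /=.
rewrite eqr_oppLR; case: ifP => _; last by rewrite rmorph0.
by rewrite rmorph1.
Qed.

Lemma cr_t_chi (U : set X) : clopen U ->
  cr_t * cr_C (chi K U) * cr_tV = cr_C (chi K (T @` U)).
Proof.
move=> cU; rewrite !cr_monoM addr0 mul1r rmorph1 mulr1 subrr.
congr (cr_mono 0 _); apply: lcfunP => x /=.
have TU : T @` U = hinv T @^-1` U.
  apply/seteqP; split=> [_ [y Uy <-]|y Uy] /=; first by rewrite hfunK.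
  by exists (hinv T y) => //; rewrite hinvK.
rewrite !chiE //; first by rewrite TU.
rewrite TU; apply: preimage_clopen => //; exact: hinv_cont.
Qed.

End Crossed.

Definition pos_def_involution (K : fieldType) (conj : {rmorphism K -> K}) : Prop :=
  involutive conj /\
  forall (r : nat) (a : 'I_r -> K), (1 <= r)%N ->
    \sum_(i < r) conj (a i) * a i = 0 -> forall i, a i = 0.

Record sylvester_rank_function (S : pzRingType) (R : realType)
    (rk : forall m n : nat, 'M[S]_(m, n) -> R) : Prop := SylvesterRank {
  sylv_ge0 : forall m n (M : 'M[S]_(m, n)), 0 <= rk m n M;
  sylv0 : forall m n, rk m n 0 = 0;
  sylv1 : rk 1 1 1%:M = 1;
  sylvM : forall m n p (M1 : 'M[S]_(m, n)) (M2 : 'M[S]_(n, p)),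
    rk m p (M1 *m M2) <= Num.min (rk m n M1) (rk n p M2);
  sylv_diag : forall m n m' n' (M1 : 'M[S]_(m, n)) (M2 : 'M[S]_(m', n')),
    rk (m + m')%N (n + n')%N (block_mx M1 0 0 M2) = rk m n M1 + rk m' n' M2;
  sylv_trig : forall m n m' n' (M1 : 'M[S]_(m, n)) (M2 : 'M[S]_(m', n'))
      (M3 : 'M[S]_(m, n')),
    rk (m + m')%N (n + n')%N (block_mx M1 M3 0 M2) >= rk m n M1 + rk m' n' M2 }.

Definition betti (S : pzRingType) (R : realType)
    (rk : forall m n : nat, 'M[S]_(m, n) -> R) (k : nat) (A : 'M[S]_k) : R :=
  k%:R - rk k k A.

Section Measure.
Variables (X : ptopologicalType) (R : realType).

Definition borelType := g_sigma_algebraType (@open X).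

Variable mu : {measure set borelType -> \bar R}.

Definition invariant_measure (T : X -> X) : Prop :=
  forall A : set borelType, measurable A -> mu (T @^-1` A) = mu A.

Definition ergodic (T : X -> X) : Prop :=
  forall A : set borelType, measurable A -> T @^-1` A = A ->
    mu A = 0%E \/ mu A = 1%E.

Definition full_measure : Prop :=
  forall U : set X, open U -> U !=set0 -> (0 < mu U)%E.

End Measure.

(* The two conditions that characterize rk_A for A = C_K(X) x_T Z *)
Definition crossed_rank (X : ptopologicalType) (K : fieldType) (T : homeo X)
    (R : realType) (mu : {measure set (borelType X) -> \bar R})
    (rk : forall m n : nat, 'M[crossed K T]_(m, n) -> R) : Prop :=
  sylvester_rank_function rk /\
  forall U : set X, clopen U -> (rk 1%N 1%N (cr_C T (chi K U))%:M)%:E = mu U.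

Section Subalgebra.
Variables (X : ptopologicalType) (K : fieldType) (T : homeo X).
Variable conj : {rmorphism K -> K}.

Definition unital_star_subalgebra (S : set (crossed K T)) : Prop :=
  [/\ S 1,
      forall a b, S a -> S b -> S (a + b),
      forall (x : K) a, S a -> S (x *: a),
      forall a b, S a -> S b -> S (a * b)
    & forall a, S a -> S (cr_star conj a)].

(* A(E, P), for P a partition of the complement of E *)
Definition partition_subalgebra (P : set (set X)) : set (crossed K T) :=
  smallest unital_star_subalgebra
    [set cr_C T (chi K Z) * cr_t K T | Z in P].

End Subalgebra.

Definition clopen_partition (X : ptopologicalType) (P : set (set X))
    (A : set X) : Prop :=
  [/\ finite_set P, partition P id A & forall Z, P Z -> clopen Z].

Section Returns.
Variables (X : ptopologicalType) (K : fieldType) (T : homeo X).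
Variables (E : set X) (P : set (set X)).

(* W = E & T^(-1)(Z_1) & .. & T^(-l+1)(Z_(l-1)) & T^(-l)(E), non-empty *)
Definition return_set (l : nat) (W : set X) : Prop :=
  [/\ (1 <= l)%N, W !=set0
    & exists2 Z : nat -> set X,
        forall i, (1 <= i < l)%N -> P (Z i)
      & W = E `&` \bigcap_(i in [set i : nat | (1 <= i < l)%N])
                    (iter i T @^-1` Z i)
              `&` iter l T @^-1` E].

(* The set of sets written V in blackboard bold *)
Definition return_sets : set (set X) := [set W | exists l, return_set l W].

(* |W|, uniquely determined by W by return_set_uniq below *)
Definition return_len (W : set X) : nat := xget 0%N [set l | return_set l W].

Lemma return_set_uniq (W : set X) (l l' : nat) : clopen_partition P (~` E) ->
  return_set l W -> return_set l' W -> l = l'.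
Proof.
move=> [_ [PE _ _] _].
have lt_absurd m m' : (m < m')%N -> return_set m W -> return_set m' W -> False.
  move=> mm' [m1 [x Wx] [Z ZP WE]] [_ _ [Z' ZP' WE']].
  have /= Em : (iter m T @^-1` E) x by move: Wx; rewrite WE => -[].
  have mm1 : (1 <= m < m')%N by rewrite m1.
  have : (~` E) (iter m T x).
    rewrite -PE; exists (Z' m); first exact: ZP'.
    by move: Wx; rewrite WE' => -[[_ +] _] => /(_ m mm1).
  exact.
move=> Wl Wl'; have [ll'|ll'|//] := ltngtP l l'.
- by case: (lt_absurd _ _ ll' Wl Wl').
- by case: (lt_absurd _ _ ll' Wl' Wl).
Qed.

Lemma return_lenE (W : set X) (l : nat) : clopen_partition P (~` E) ->
  return_set l W -> return_len W = l.
Proof.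
move=> cP Wl; apply: (@return_set_uniq W) => //.
by apply: (@xgetPex _ 0%N [set l | return_set l W]); exists l.
Qed.

(* The matrix unit e_ij(W) *)
Definition mx_unit (W : set X) (i j : nat) : crossed K T :=
  (cr_C T (chi K (~` E)) * cr_t K T) ^+ i * cr_C T (chi K W)
    * (cr_tV K T * cr_C T (chi K (~` E))) ^+ j.

Definition central_proj (W : set X) : crossed K T :=
  \sum_(i < return_len W) mx_unit W i i.

(* The element h_W a of h_W B as a matrix over K: its coordinates along the
   matrix units e_ij(W), which are linearly independent and span h_W B *)
Definition pi_comp (W : set X) (a : crossed K T) : 'M[K]_(return_len W) :=
  xget 0 [set M : 'M[K]_(return_len W) |
    central_proj W * a = \sum_i \sum_j M i j *: mx_unit W i j].

(* The block matrix pi(A)_W, of size \sum_(i < k) |W| = k * |W| *)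
Definition pi_comp_mx (k : nat) (W : set X) (A : 'M[crossed K T]_k) :
    'M[K]_(\sum_(i < k) return_len W) :=
  \mxblock_(i < k, j < k) pi_comp W (A i j).

End Returns.

(* dim ker M for M acting on K^n by left multiplication *)
Definition dim_ker (K : fieldType) (n : nat) (M : 'M[K]_n) : nat :=
  \dim (lker (linfun (mulmx M : 'cV[K]_n -> 'cV[K]_n))).

(* Main.v *)
Require Import Defs.
From HB Require Import structures.
From mathcomp Require Import all_boot all_order all_algebra.
From mathcomp Require Import finmap.
From mathcomp Require Import all_classical all_reals all_analysis.
From mathcomp Require Import zify lra.
Set Implicit Arguments.
Unset Strict Implicit.
Unset Printing Implicit Defensive.
Import Order.TTheory GRing.Theory Num.Theory.
Local Open Scope classical_set_scope.
Local Open Scope ring_scope.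

(** The rank of a matrix [A] over the subalgebra is computed tower by tower.
    For a return set [W] the sets [W], [T W], .., [T^(|W|-1) W] are pairwise
    disjoint, and towers over different return sets are disjoint as well; in
    the crossed product this says that the [e_ij(W)] are matrix units and that
    the [h_W] are orthogonal idempotents.  They commute with the generators
    [chi_Z t], because a level of a tower other than the base lies inside a
    single piece of the partition, and the base and the set just above the top
    level lie in [E]; hence [h_W] is central and [h_W a] is a combination of
    the [e_ij(W)] for every [a] in the subalgebra ([central_proj_span]).

    Any Sylvester rank function is determined on such a corner: if [e_ij] are
    matrix units and [B] has coordinate matrix [M], then [B] factors through
    [e_oo] times [M] and conversely, so [rk B = rank(M) rk(e_oo)]
    ([rk_mx_units]).  Here [rk(e_00(W)) = rk(chi_W) = mu(W)].  Summing over a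
    finite set [F] of return sets, with [h_F] the sum of the [h_W],
      [sum_F mu(W) dim ker pi(A)_W = k rk(h_F) - rk(h_F A)],
    and since [0 <= rk A - rk(h_F A) <= k (1 - rk(h_F))] the partial sum lies
    below the Betti number by at most [k (1 - rk(h_F))], where
    [rk(h_F) = sum_F |W| mu(W)] ([betti_sum_bounds]).

    It remains that the towers fill the space ([towers_exhaust]).  By
    ergodicity and fullness almost every orbit visits [E] both in the past and
    in the future, and such a point lies in the tower over the return set that
    records its itinerary between the two nearest visits.  There are finitely
    many return sets of each length, so finitely many towers carry all but
    [eps] of the mass. *)

(** * Kernel dimension and rank *)

(** Column vectors killed by [M] are the transposes of the row space of
    [kermx M^T], which a row basis parametrizes injectively. *)
Lemma dim_kerE (K : fieldType) (n : nat) (M : 'M[K]_n) :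
  dim_ker M = (n - \rank M)%N.
Proof.
pose B := (row_base (kermx M^T))^T.
pose f : 'Hom('cV[K]_n, 'cV[K]_n) := linfun (mulmx M).
pose g : 'Hom('cV[K]_(\rank (kermx M^T)), 'cV[K]_n) := linfun (mulmx B).
have fE v : f v = M *m v by rewrite lfunE.
have gE v : g v = B *m v by rewrite lfunE.
have limg_lker : limg g = lker f.
  apply/vspaceP => v; rewrite memv_ker fE; apply/memv_imgP/eqP.
    move=> [w _ ->]; rewrite gE mulmxA; apply: trmx_inj.
    rewrite trmx0 !trmx_mul trmxK.
    have /sub_kermxP -> : (row_base (kermx M^T) <= kermx M^T)%MS.
      by rewrite eq_row_base.
    by rewrite mulmx0.
  move=> Mv; have : (v^T <= row_base (kermx M^T))%MS.
    by rewrite eq_row_base; apply/sub_kermxP; rewrite -trmx_mul Mv trmx0.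
  move=> /submxP[D vE]; exists D^T; rewrite ?memvf //.
  by rewrite gE /B -trmx_mul -vE trmxK.
have /lker0P injg : injective g.
  move=> v w; rewrite !gE => /(congr1 trmx); rewrite !trmx_mul trmxK.
  by move=> /(row_free_inj (row_base_free _)) /trmx_inj.
rewrite /dim_ker -/f -limg_lker limg_dim_eq ?(eqP injg) ?capv0 //.
by rewrite dimvf /dim /= muln1 mxrank_ker mxrank_tr.
Qed.

(** * Sylvester rank functions *)

Section SylvesterRank.
Variables (S : pzRingType) (R : realType).
Variable rk : forall m n : nat, 'M[S]_(m, n) -> R.
Hypothesis hrk : sylvester_rank_function rk.
Local Notation "\rk M" := (@rk _ _ M) (at level 10, M at level 8).

Lemma rk_mul_lel m n p (A : 'M[S]_(m, n)) (B : 'M[S]_(n, p)) :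
  \rk (A *m B) <= \rk A.
Proof. by have := sylvM hrk A B; rewrite le_min => /andP[]. Qed.

Lemma rk_mul_ler m n p (A : 'M[S]_(m, n)) (B : 'M[S]_(n, p)) :
  \rk (A *m B) <= \rk B.
Proof. by have := sylvM hrk A B; rewrite le_min => /andP[]. Qed.

(** [A + B] is a compression of the block diagonal matrix of [A] and [B]. *)
Lemma rk_add_le m n (A B : 'M[S]_(m, n)) : \rk (A + B) <= \rk A + \rk B.
Proof.
have -> : A + B = row_mx 1%:M 1%:M *m block_mx A 0 0 B *m col_mx 1%:M 1%:M.
  by rewrite mul_row_block mul_row_col !mulmx0 !mul1mx !mulmx1 addr0 add0r.
apply: le_trans (rk_mul_lel _ _) _; apply: le_trans (rk_mul_ler _ _) _.
by rewrite sylv_diag.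
Qed.

(** With orthogonal supports on both sides, the block diagonal matrix can be
    recovered from the sum, so subadditivity is an equality. *)
Lemma rk_orth k (P Q A B : 'M[S]_k) : P *m Q = 0 -> Q *m P = 0 ->
  P *m A *m P = A -> Q *m B *m Q = B -> \rk (A + B) = \rk A + \rk B.
Proof.
move=> PQ QP PAP QBQ; apply/eqP; rewrite eq_le rk_add_le /= -sylv_diag //.
have -> : block_mx A 0 0 B = col_mx P Q *m (A + B) *m row_mx P Q.
  have PB : P *m B = 0 by rewrite -QBQ !mulmxA PQ !mul0mx.
  have QA : Q *m A = 0 by rewrite -PAP !mulmxA QP !mul0mx.
  have AQ : A *m Q = 0 by rewrite -PAP -!mulmxA PQ !mulmx0.
  have BP : B *m P = 0 by rewrite -QBQ -!mulmxA QP !mulmx0.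
  rewrite mul_col_mx !mulmxDr PB QA addr0 add0r mul_col_row PAP QBQ.
  by rewrite -!mulmxA AQ BP !mulmx0.
by apply: le_trans (rk_mul_lel _ _) _; apply: rk_mul_ler.
Qed.

Lemma rk_scalar k (x : S) : \rk (x%:M : 'M[S]_k) = k%:R * \rk (x%:M : 'M[S]_1).
Proof.
elim: k => [|k IH]; first by rewrite flatmx0 sylv0 ?mul0r.
have := sylv_diag hrk (x%:M : 'M[S]_1) (x%:M : 'M[S]_k).
rewrite -scalar_mx_block add1n IH => ->.
by rewrite -(add1n k) natrD mulrDl mul1r.
Qed.

(** [e] and [1 - e] have orthogonal supports and add up to the unit. *)
Lemma rk_idem_compl (e : S) : e * e = e ->
  \rk (e%:M : 'M[S]_1) + \rk ((1 - e)%:M : 'M[S]_1) = 1.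
Proof.
move=> ee; have ff : (1 - e) * (1 - e) = 1 - e.
  by rewrite mulrBr mulr1 mulrBl mul1r ee subrr subr0.
rewrite -(rk_orth (P := e%:M) (Q := (1 - e)%:M)).
- by rewrite -raddfD addrC subrK sylv1.
- by rewrite -scalar_mxM mulrBr mulr1 ee subrr raddf0.
- by rewrite -scalar_mxM mulrBl mul1r ee subrr raddf0.
- by rewrite -!scalar_mxM !ee.
- by rewrite -!scalar_mxM !ff.
Qed.

(** Cutting by [e] loses at most the rank of [1 - e], once for each row. *)
Lemma rk_compress_ge k (e : S) (A : 'M[S]_k) : e * e = e ->
  \rk A - \rk (e%:M *m A) <= k%:R * (1 - \rk (e%:M : 'M[S]_1)).
Proof.
move=> ee; have -> : 1 - \rk (e%:M : 'M[S]_1) = \rk ((1 - e)%:M : 'M[S]_1).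
  by rewrite -(rk_idem_compl ee) addrAC subrr add0r.
rewrite -rk_scalar lerBlDr addrC.
have {1}-> : A = e%:M *m A + (1 - e)%:M *m A.
  by rewrite -mulmxDl -raddfD addrC subrK mul1mx.
by apply: le_trans (rk_add_le _ _) _; rewrite lerD2l rk_mul_lel.
Qed.

End SylvesterRank.

Section MatrixUnits.
Variables (K : fieldType) (S : algType K) (R : realType).
Variable rk : forall m n : nat, 'M[S]_(m, n) -> R.
Hypothesis hrk : sylvester_rank_function rk.
Local Notation "\rk M" := (@rk _ _ M) (at level 10, M at level 8).

(** The tensor product of [e] with the matrix [M].  For [e] idempotent it embeds
    matrices over [K] multiplicatively, with the unit sent to the scalar
    matrix of [e]. *)
Definition scalar_tensor (e : S) m n (M : 'M[K]_(m, n)) : 'M[S]_(m, n) :=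
  map_mx (fun c => c *: e) M.

Lemma scalar_tensorM e m n p (M : 'M[K]_(m, n)) (N : 'M[K]_(n, p)) :
  e * e = e -> scalar_tensor e M *m scalar_tensor e N =
    scalar_tensor e (M *m N).
Proof.
move=> ee; apply/matrixP => i j; rewrite !mxE scaler_suml.
by apply: eq_bigr => s _; rewrite !mxE -scalerAl -scalerAr ee scalerA.
Qed.

Lemma scalar_tensor1 e n : scalar_tensor e (1%:M : 'M[K]_n) = e%:M.
Proof.
apply/matrixP => i j; rewrite !mxE.
by case: eqP => _; rewrite ?scale1r ?scale0r.
Qed.

(** A rank factorization of [M] bounds the rank by that of a scalar matrix of
    size [\rank M]; one-sided inverses of the two factors give the converse. *)
Lemma rk_scalar_tensor e m n (M : 'M[K]_(m, n)) : e * e = e ->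
  \rk (scalar_tensor e M) = (\rank M)%:R * \rk (e%:M : 'M[S]_1).
Proof.
move=> ee; rewrite -(rk_scalar hrk) -scalar_tensor1; apply/eqP; rewrite eq_le.
apply/andP; split.
  rewrite -{1}(mulmx_base M) -[col_base M]mulmx1 -!(scalar_tensorM _ _ ee).
  by apply: le_trans (rk_mul_lel hrk _ _) _; apply: rk_mul_ler.
have -> : 1%:M = pinvmx (col_base M) *m M *m pinvmx (row_base M).
  rewrite -[X in pinvmx _ *m X](mulmx_base M) mulmxA mulVpmx ?col_base_full //
    mul1mx.
  by rewrite mulmxVp ?row_base_free.
rewrite -!(scalar_tensorM _ _ ee).
by apply: le_trans (rk_mul_lel hrk _ _) _; apply: rk_mul_ler.
Qed.

Variables (l : nat) (e : 'I_l -> 'I_l -> S) (o : 'I_l).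
Hypothesis eM : forall i j p q, e i j * e p q = if j == p then e i q else 0.

(** [B = U (e_oo M) V] and [e_oo M = V B U], where the blocks of [U] and [V] are
    the row of the [e_io] and the column of the [e_oj], so the two matrices
    have the same rank. *)
Lemma rk_mx_units k (B : 'M[S]_k) (M : 'I_k -> 'I_k -> 'M[K]_l) :
  (forall a b, B a b = \sum_i \sum_j M a b i j *: e i j) ->
  \rk B =
    (\rank (\mxblock_(a < k, b < k) M a b))%:R * \rk ((e o o)%:M : 'M[S]_1).
Proof.
move=> BE; have ee : e o o * e o o = e o o by rewrite eM eqxx.
pose U (b : 'I_k) := \matrix_(a < k, i < l) (if a == b then e i o else 0).
pose V (a : 'I_k) := \matrix_(i < l, b < k) (if a == b then e o i else 0).
rewrite -rk_scalar_tensor //; set N := mxblock _.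
have tE : scalar_tensor (e o o) N =
    \mxblock_(a < k, b < k) scalar_tensor (e o o) (M a b).
  by apply/matrixP => i j; rewrite !mxE.
(* [V U] is scalar because [e_oi e_jo] is [e_oo] for [i = j] and 0 otherwise. *)
have UV : \mxcol_a V a *m \mxrow_b U b = (e o o)%:M.
  rewrite mul_mxcol_mxrow -mxdiagZ; apply/eq_mxblockP => a b.
  case: eqVneq => [->|ab].
    rewrite conform_mx_id; apply/matrixP => i j; rewrite !mxE (bigD1 b) //=.
    rewrite big1 ?addr0 => [|c cb];
      last by rewrite !mxE eq_sym (negPf cb) mul0r.
    by rewrite !mxE eqxx eM; case: (i == j).
  apply/matrixP => i j; rewrite !mxE big1 // => c _; rewrite !mxE.
  case: eqP => [<-|_]; last by rewrite mul0r.
  by rewrite (negPf ab) mulr0.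
have BU : B = \mxrow_b U b *m scalar_tensor (e o o) N *m \mxcol_a V a.
  rewrite tE mul_mxrow_mxblock mul_mxrow_mxcol; apply/matrixP => a b.
  rewrite summxE.
  have UME b' : (\sum_i U i *m scalar_tensor (e o o) (M i b')) =
    \matrix_(a < k, i < l) \sum_j M a b' j i *: e j o.
    apply/matrixP => x y; rewrite summxE (bigD1 x) //= big1 ?addr0 => [|c ca].
      rewrite !mxE; apply: eq_bigr => j _.
      by rewrite !mxE eqxx -scalerAr eM eqxx.
    by rewrite !mxE big1 // => i _; rewrite !mxE eq_sym (negPf ca) mul0r.
  transitivity (\sum_b' ((\matrix_(a < k, i < l) \sum_j M a b' j i *: e j o)
      *m V b') a b); last by apply: eq_bigr => b' _; rewrite -UME.
  rewrite (bigD1 b) //= big1 ?addr0 => [|c cb]; last first.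
    by rewrite !mxE big1 // => i _; rewrite !mxE (negPf cb) mulr0.
  rewrite BE !mxE exchange_big; apply: eq_bigr => j _.
  rewrite !mxE eqxx mulr_suml; apply: eq_bigr => i _.
  by rewrite -scalerAl eM eqxx.
have NU : scalar_tensor (e o o) N = \mxcol_a V a *m B *m \mxrow_b U b.
  rewrite BU !mulmxA UV -mulmxA UV -scalar_tensor1.
  by rewrite !scalar_tensorM // mulmx1 mul1mx.
apply/eqP; rewrite eq_le; apply/andP; split.
  rewrite BU; apply: le_trans (rk_mul_lel hrk _ _) _; exact: rk_mul_ler.
rewrite NU; apply: le_trans (rk_mul_lel hrk _ _) _; exact: rk_mul_ler.
Qed.
End MatrixUnits.

(** * Return sets and their towers *)

Section ReturnSets.
Variables (X : ptopologicalType) (T : homeo X) (E : set X) (P : set (set X)).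
Hypothesis cP : clopen_partition P (~` E).
Local Notation ret := (return_set T E P).

Lemma hpow_iter (n : nat) x : hpow T n x = iter n T x.
Proof. by []. Qed.

Lemma return_set_itinerary l W x : ret l W -> W x ->
  [/\ E x, E (iter l T x) & forall m, (1 <= m < l)%N -> ~ E (iter m T x)].
Proof.
have [_ [PE _ _] _] := cP; move=> [_ _ [Z ZP ->]] [[Ex Zx] Elx];
  split=> // m ml.
by change ((~` E) (iter m T x)); rewrite -PE; exists (Z m);
  [exact: ZP|exact: Zx].
Qed.

(** A common point has one return time, and one piece of the partition at each
    intermediate time. *)
Lemma return_set_trivI l l' W W' x : ret l W -> ret l' W' -> W x -> W' x ->
  W = W'.
Proof.
move=> Wl Wl' Wx W'x; have [l1 _ [Z ZP WE]] := Wl;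
  have [l1' _ [Z' ZP' WE']] := Wl'.
have [_ Elx nE] := return_set_itinerary Wl Wx.
have [_ Elx' nE'] := return_set_itinerary Wl' W'x.
have ll' : l = l'.
  have [ll'|ll'|//] := ltngtP l l'; first by case: (nE' l); rewrite ?l1.
  by case: (nE l'); rewrite ?l1'.
have [_ [_ tP _] _] := cP; rewrite {}WE {}WE' -{}ll' in Wx W'x ZP' *.
congr (_ `&` _ `&` _); apply: eq_bigcapr => m ml; congr (_ @^-1` _).
apply: (tP (Z m) (Z' m)) => //; [exact: ZP|exact: ZP'|].
by exists (iter m T x); split; [apply: Wx.1.2|apply: W'x.1.2].
Qed.

(** The level of a point in a tower is the time elapsed since its last visit
    to [E]; this point of [E] then lies in a single return set. *)
Lemma tower_trivI l l' W W' (i j : nat) x : ret l W -> ret l' W' ->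
  (i < l)%N -> (j < l')%N -> W (hpow T (- i%:Z) x) -> W' (hpow T (- j%:Z) x) ->
  W = W' /\ i = j.
Proof.
wlog ij : l l' W W' i j / (i <= j)%N.
  move=> H Wl Wl' il jl' Wx W'x; case/orP: (leq_total i j) => ij.
    exact: H il jl' Wx W'x.
  by have [-> ->] := H _ _ _ _ _ _ ij Wl' Wl jl' il W'x Wx.
move=> Wl Wl' il jl' Wx W'x; have [ijE|ij'] := eqVneq i j.
  by rewrite -ijE in W'x; split=> //; apply: return_set_trivI Wl Wl' Wx W'x.
have [_ _ nE] := return_set_itinerary Wl' W'x.
have [Ex _ _] := return_set_itinerary Wl Wx.
case: (nE (j - i)%N); first by lia.
by rewrite -hpow_iter -hpowD (_ : _ + _ = - i%:Z) //; lia.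
Qed.

(** The tower is found from the last visit of [x] to [E], at time [- i], and the
    first one after time 0, at time [j.+1]. *)
Lemma tower_cover x (i0 j0 : nat) :
  E (hpow T (- i0%:Z) x) -> E (iter j0.+1 T x) ->
  exists l W (i : nat), [/\ ret l W, (i < l)%N & W (hpow T (- i%:Z) x)].
Proof.
move=> Ei0 Ej0.
have exi : exists i, (fun i : nat => `[< E (hpow T (- i%:Z) x) >]) i.
  by exists i0; apply/asboolP.
have exj : exists j, (fun j : nat => `[< E (iter j.+1 T x) >]) j.
  by exists j0; apply/asboolP.
case: (ex_minnP exi) => i /asboolP Ei mini.
case: (ex_minnP exj) => j /asboolP Ej minj.
pose y := hpow T (- i%:Z) x.
have iterE m : iter m T y = hpow T (m%:Z - i%:Z) x by rewrite -hpow_iter -hpowD.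
have nE m : (1 <= m < i + j.+1)%N -> ~ E (iter m T y).
  move=> /andP[m1 ml]; rewrite iterE; have [mi|im] := leqP m i.
    rewrite (_ : m%:Z - i%:Z = - (i - m)%N%:Z); last by lia.
    by move=> /asboolP /mini; lia.
  rewrite (_ : m%:Z - i%:Z = (m - i).-1.+1%:Z); last by lia.
  by rewrite hpow_iter => /asboolP /minj; lia.
have [_ [PE _ _] _] := cP.
have exZ m : exists Z, (1 <= m < i + j.+1)%N -> P Z /\ Z (iter m T y).
  have [ml|] := boolP (1 <= m < i + j.+1)%N; last by exists set0.
  have : (~` E) (iter m T y) by exact: nE.
  by rewrite -PE => -[Z PZ Zy]; exists Z.
have /choice[Z ZP] := exZ.
exists (i + j.+1)%N, (E `&` \bigcap_(m in [set m : nat | (1 <= m < i + j.+1)%N])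
  (iter m T @^-1` Z m) `&` iter (i + j.+1) T @^-1` E), i.
suff Wy : (E `&` \bigcap_(m in [set m : nat | (1 <= m < i + j.+1)%N])
  (iter m T @^-1` Z m) `&` iter (i + j.+1) T @^-1` E) y.
  split=> //; last by lia.
  by split; [lia|exists y|exists Z => // m /ZP[]].
split; first by split=> // m /ZP[].
rewrite /= iterE (_ : (i + j.+1)%N%:Z - i%:Z = j.+1%:Z) ?hpow_iter //; lia.
Qed.

Lemma bigcap_itinerary0 (F : nat -> set X) l : (l <= 1)%N ->
  \bigcap_(i in [set i : nat | (1 <= i < l)%N]) F i = setT.
Proof. by move=> l1; apply/seteqP; split=> // x _ i /= il; lia. Qed.

Lemma bigcap_itinerary_recr (F : nat -> set X) l : (1 <= l)%N ->
  \bigcap_(i in [set i : nat | (1 <= i < l.+1)%N]) F i =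
  \bigcap_(i in [set i : nat | (1 <= i < l)%N]) F i `&` F l.
Proof.
move=> l1; apply/seteqP; split=> [x Fx|x [Fx Flx] i /= il].
  by split=> [i /= il|]; apply: Fx => /=; lia.
by have [->//|il'] := eqVneq i l; apply: Fx => /=; lia.
Qed.

Lemma clopen_iter n (U : set X) : clopen U -> clopen (iter n T @^-1` U).
Proof.
by move=> cU; apply: preimage_clopen => //; exact: (@hpow_cont _ T n).
Qed.

Lemma return_set_clopen l W : clopen E -> ret l W -> clopen W.
Proof.
have [_ _ Pc] := cP; move=> cE [_ _ [Z ZP ->]].
apply: clopenI; last exact: clopen_iter.
apply: clopenI => //; elim: l ZP => [|[|l] IH] ZP.
- by rewrite bigcap_itinerary0 //; exact: clopenT.
- by rewrite bigcap_itinerary0 //; exact: clopenT.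
rewrite bigcap_itinerary_recr //; apply: clopenI.
  by apply: IH => i il; apply: ZP; lia.
by apply/clopen_iter/Pc/ZP; lia.
Qed.

(** By induction on the length, there are finitely many possible itineraries
    through the finite partition. *)
Lemma finite_return_sets_len l : finite_set [set W | ret l W].
Proof.
have [fP _ _] := cP.
pose C l := [set B | exists2 Z : nat -> set X,
  forall i, (1 <= i < l)%N -> P (Z i)
  & B = \bigcap_(i in [set i : nat | (1 <= i < l)%N]) (iter i T @^-1` Z i)].
case: l => [|l]; first by apply: (@sub_finite_set _ _ set0) => // W [].
suff fC : finite_set (C l.+1).
  apply: sub_finite_set
    (finite_image (fun B => E `&` B `&` iter l.+1 T @^-1` E) fC).
  move=> W [_ _ [Z ZP ->]].
  by exists (\bigcap_(i in [set i : nat | (1 <= i < l.+1)%N])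
    (iter i T @^-1` Z i)) => //; exists Z.
elim: l => [|l IH].
  apply: sub_finite_set (finite_set1 setT) => B [Z _ ->].
  by rewrite bigcap_itinerary0.
have /sub_finite_set :=
  finite_image2 (fun B Z => B `&` iter l.+1 T @^-1` Z) IH fP.
apply => B [Z ZP ->]; rewrite bigcap_itinerary_recr //.
exists (\bigcap_(i in [set i : nat | (1 <= i < l.+1)%N]) (iter i T @^-1` Z i)).
  by exists Z => // i il; apply: ZP; lia.
by exists (Z l.+1) => //; apply: ZP; lia.
Qed.

End ReturnSets.

(** * Recurrence *)

Section Recurrence.
Variables (X : ptopologicalType) (R : realType).
Variable mu : probability (borelType X) R.
Local Open Scope ereal_scope.

Lemma open_borel (U : set X) : open U -> measurable (U : set (borelType X)).
Proof. exact: sub_sigma_algebra. Qed.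

(** The increasing union of the iterated preimages of [U] is invariant and has
    the measure of [U], by continuity from below. *)
Lemma mu_expanding (S : X -> X) (U : set X) : continuous S ->
  (forall V : set X, open V -> mu (S @^-1` V) = mu V) ->
  (forall V : set X, open V -> S @^-1` V = V -> mu V = 0 \/ mu V = 1) ->
  open U -> U `<=` S @^-1` U -> 0 < mu U -> mu U = 1.
Proof.
move=> cS inv erg oU US U0; pose F n := iter n S @^-1` U.
have SF n : S @^-1` F n = F n.+1.
  by apply/seteqP; split=> x; rewrite /F /= -iterSr.
have oF n : open (F n).
  elim: n => [//|n IH]; rewrite -SF; apply: open_comp => //.
have oUF : open (\bigcup_n F n) by apply: bigcup_open.
have muF n : mu (F n) = mu U by elim: n => [//|n IH]; rewrite -SF inv.
have ndF : {homo F : m n / (m <= n)%N >-> (m <= n)%O}.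
  by apply/nondecreasing_seqP => n; apply/subsetPset => x /=; apply: US.
have muUF : mu (\bigcup_n F n) = mu U.
  have := @nondecreasing_cvg_mu _ _ _ mu F (fun n => open_borel (oF n))
    (open_borel oUF) ndF.
  have -> : mu \o F = cst (mu U) by apply/funext => n /=; rewrite muF.
  by move=> /(cvg_lim (@ereal_hausdorff R)) <-; rewrite lim_cst.
have SUF : S @^-1` (\bigcup_n F n) = \bigcup_n F n.
  apply/seteqP; split=> [x [n _ Fx]|x [n _ Fx]].
    by exists n.+1 => //; rewrite -SF.
  exists n => //; have /subsetPset/(_ x Fx) := ndF n n.+1 (leqnSn n).
  by rewrite -SF.
have [] := erg _ oUF SUF; rewrite muUF // => U00.
by rewrite U00 ltxx in U0.
Qed.

Lemma mu_setI1 (U V : set X) : open U -> open V -> mu U = 1 -> mu V = 1 ->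
  mu (U `&` V) = 1.
Proof.
move=> /open_borel mU /open_borel mV U1 V1; rewrite -[U `&` V]setCK setCI.
have mUC : measurable (~` U : set (borelType X)) by exact: measurableC.
have mVC : measurable (~` V : set (borelType X)) by exact: measurableC.
have V0 : mu (~` V) = 0 by rewrite probability_setC // V1 subee.
rewrite probability_setC; last exact: measurableU.
have U0 : mu (~` U) = 0 by rewrite probability_setC // U1 subee.
have -> : mu (~` U `|` ~` V) = 0 by exact: etrans (measureU0 mUC mVC V0) U0.
by rewrite sube0.
Qed.

Variables (T : homeo X) (E : set X) (P : set (set X)).
Hypotheses (mu_inv : invariant_measure mu T) (mu_erg : ergodic mu T).
Hypotheses (mu_full : full_measure mu) (E0 : E !=set0) (cE : clopen E).
Hypothesis cP : clopen_partition P (~` E).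
Local Notation ret := (return_set T E P).

Lemma hinv_inv (U : set X) : open U -> mu (hinv T @^-1` U) = mu U.
Proof.
move=> oU; rewrite -[LHS]mu_inv.
  by congr (mu _); apply/seteqP; split=> x; rewrite /= hfunK.
by apply: open_borel; apply: open_comp => // x _; exact: hinv_cont.
Qed.

Lemma hpow_preimage_open (n : int) (U : set X) : open U ->
  open (hpow T n @^-1` U).
Proof. by move=> oU; apply: open_comp => // x _; exact: hpow_cont. Qed.

Lemma mu_hpowN (n : nat) (U : set X) : open U ->
  mu (hpow T (- n%:Z) @^-1` U) = mu U.
Proof.
move=> oU; elim: n => [//|n IH]; rewrite -[RHS]IH -[RHS]hinv_inv; last first.
  exact: hpow_preimage_open.
congr (mu _); apply/seteqP.
suff e x : hpow T (- n.+1%:Z) x = hpow T (- n%:Z) (hinv T x).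
  by split=> x; rewrite /preimage /mkset e.
by rewrite -(hpowN1 T x) -hpowD; congr (hpow _ _ _); lia.
Qed.

Lemma mu_visited_past : mu (\bigcup_(i : nat) hpow T (- i%:Z) @^-1` E) = 1.
Proof.
have oE n : open (hpow T n @^-1` E).
  by case: cE => oE _; apply: hpow_preimage_open.
have oU : open (\bigcup_(i : nat) hpow T (- i%:Z) @^-1` E).
  exact: bigcup_open.
apply: (mu_expanding (S := T)) => //.
- exact: hfun_cont.
- by move=> V oV; apply: mu_inv; exact: open_borel.
- by move=> V oV; apply: mu_erg; exact: open_borel.
- move=> x [i _ /= Ex]; exists i.+1 => //; rewrite /preimage /mkset.
  rewrite -(hpow1 T x) -hpowD.
  by rewrite (_ : - i.+1%:Z + 1 = - i%:Z)%R //; lia.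
- by apply: mu_full => //; have [x Ex] := E0; exists x; exists 0%N.
Qed.

Lemma mu_visits_future : mu (\bigcup_(j : nat) iter j.+1 T @^-1` E) = 1.
Proof.
have oE n : open (iter n T @^-1` E) by case: (clopen_iter T n cE).
have oU : open (\bigcup_(j : nat) iter j.+1 T @^-1` E) by apply: bigcup_open.
(* This set grows under the inverse of [T], so the roles are reversed. *)
apply: (mu_expanding (S := hinv T)) => //.
- exact: hinv_cont.
- exact: hinv_inv.
- move=> V oV VV; apply: mu_erg; first exact: open_borel.
  by rewrite -{1}VV; apply/seteqP; split=> x; rewrite /= hfunK.
- by move=> x [i _ /= Ex]; exists i.+1 => //=; rewrite -iterS iterSr hinvK.
- apply: mu_full => //; have [x Ex] := E0; exists (hinv T x); exists 0%N => //=.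
  by rewrite hinvK.
Qed.

(** The union of the towers of height less than [N] increases with [N] to a set
    of full measure, and Boole's inequality bounds its measure by the sum over
    the finitely many towers. *)
Lemma towers_exhaust (eps : R) : (0 < eps)%R ->
  exists F : set (set X), [/\ finite_set F, F `<=` return_sets T E P &
    (1 - eps)%:E <= \sum_(W \in F) (mu W * (return_len T E P W)%:R%:E)].
Proof.
move=> eps0; pose V N : set (set X) := [set W | exists2 l, (l < N)%N & ret l W].
pose tower W :=
  \bigcup_(i in `I_(return_len T E P W)) (hpow T (- i%:Z) @^-1` W).
pose G N := \bigcup_(W in V N) tower W.
have retC W l : ret l W -> open W by move=> /(return_set_clopen cP cE)[].
have oT W l : ret l W -> open (tower W).
  by move=> /retC oW; apply: bigcup_open => i _; exact: hpow_preimage_open.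
have oG N : open (G N) by apply: bigcup_open => W [l _ /oT].
have oUG : open (\bigcup_N G N) by apply: bigcup_open.
have ndG : {homo G : m n / (m <= n)%N >-> (m <= n)%O}.
  move=> m n mn; apply/subsetPset => x [W [l lm Wl] Wx]; exists W => //.
  by exists l => //; apply: leq_trans mn.
have muG : mu (\bigcup_N G N) = 1.
  apply/eqP; rewrite eq_le probability_le1 /=; last exact: open_borel.
  have oE n : open (hpow T n @^-1` E).
    by case: cE => oE _; apply: hpow_preimage_open.
  have oE' n : open (iter n T @^-1` E) by case: (clopen_iter T n cE).
  have oI : open (\bigcup_(i : nat) hpow T (- i%:Z) @^-1` E).
    exact: bigcup_open.
  have oJ : open (\bigcup_(j : nat) iter j.+1 T @^-1` E) by apply: bigcup_open.
  rewrite -(mu_setI1 oI oJ mu_visited_past mu_visits_future); apply: le_measure.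
  - by rewrite inE; apply: open_borel; exact: openI.
  - by rewrite inE; exact: open_borel.
  move=> x [[i _ Ei] [j _ Ej]];
    have [l [W [i' [Wl i'l Wx]]]] := tower_cover cP Ei Ej.
  exists l.+1 => //; exists W; first by exists l.
  by exists i' => //=; rewrite (return_lenE cP Wl).
have cvgG : mu \o G @ \oo --> 1.
  by rewrite -muG; apply: nondecreasing_cvg_mu => // *; exact: open_borel.
have [N _ GN] : \forall N \near \oo, (1 - eps)%:E < mu (G N).
  apply: (cvgG [set y | (1 - eps)%:E < y]).
  by apply: open_nbhs_nbhs; split;
    [exact: open_ereal_gt_ereal|rewrite /= lte_fin; lra].
have fV : finite_set (V N).
  have -> : V N = \bigcup_(l in `I_N) [set W | ret l W].
    by apply/seteqP; split=> [W [l lN Wl]|W [l lN Wl]]; exists l.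
  by apply: bigcup_finite => // l _; exact: finite_return_sets_len.
exists (V N); split=> //; first by move=> W [l _ Wl]; exists l.
apply: le_trans (ltW (GN N (leqnn N))) _.
apply: le_trans
  (content_sub_fsum mu fV _ (open_borel (oG N)) (@subset_refl _ _)) _.
  by move=> W [l _ /oT]; exact: open_borel.
apply: lee_fsum => // W [l _ Wl]; rewrite (return_lenE cP Wl) /tower.
rewrite (return_lenE cP Wl).
have mW i : measurable (hpow T (- i%:Z) @^-1` W : set (borelType X)).
  by apply: open_borel; apply: hpow_preimage_open; exact: retC Wl.
apply: le_trans (content_sub_fsum mu (finite_II l) (fun i _ => mW i) _
  (@subset_refl _ _)) _; first by apply: bigcup_measurable.
rewrite -fsbig_ord (eq_bigr (fun=> mu W)) => [|i _]; last first.
  by exact: mu_hpowN (retC _ _ Wl).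
by rewrite sumr_const card_ord muleC mule_natl.
Qed.

End Recurrence.

(** * Matrix units of a tower in the crossed product *)

Section Towers.
Variables (X : ptopologicalType) (K : fieldType) (T : homeo X).
Variables (E : set X) (P : set (set X)).
Hypotheses (cE : clopen E) (cP : clopen_partition P (~` E)).
Local Notation ret := (return_set T E P).
Local Notation sh := (lc_shift T).
Local Notation w := (@chi X K).
Local Notation e W := (@mx_unit X K T E W).

Lemma lc_shift_chi (W : set X) (n : int) x : clopen W ->
  sh n (w W) x = \1_W (hpow T (- n) x).
Proof. by move=> cW; rewrite -(chiE K _ cW). Qed.

Lemma chi_mul_shift (U W : set X) (i : nat) l : clopen U -> ret l W ->
  (forall y, W y -> U (iter i T y)) -> w U * sh i (w W) = sh i (w W).
Proof.
move=> cU Wl WU; have cW := return_set_clopen cP cE Wl.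
apply: lcfunP => x; rewrite lcfunM lc_shift_chi // chiE // /indic.
have [Wx|Wx] := pselect (W (hpow T (- i%:Z) x));
  last by rewrite !(memNset Wx) mulr0.
rewrite !mem_set ?mulr1 //; move: (WU _ Wx).
by rewrite -hpow_iter -hpowD subrr.
Qed.

Lemma chi_mul_shift0 (U W : set X) (i : nat) l : clopen U -> ret l W ->
  (forall y, W y -> ~ U (iter i T y)) -> w U * sh i (w W) = 0.
Proof.
move=> cU Wl WU; have cW := return_set_clopen cP cE Wl.
apply: lcfunP => x; rewrite lcfunM lc_shift_chi // chiE // /indic lcfun0.
have [Wx|Wx] := pselect (W (hpow T (- i%:Z) x));
  last by rewrite (memNset Wx) mulr0.
rewrite memNset ?mul0r //; move: (WU _ Wx).
by rewrite -hpow_iter -hpowD subrr.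
Qed.

Lemma chi_idem (W : set X) : clopen W -> w W * w W = w W.
Proof.
move=> cW; apply: lcfunP => x; rewrite lcfunM !chiE // /indic.
by case: (_ \in _); rewrite ?mulr1 ?mulr0.
Qed.

(** Distinct levels, of the same or of different towers, are disjoint. *)
Lemma tower_mul0 l l' W W' (i j : nat) : ret l W -> ret l' W' ->
  (i < l)%N -> (j < l')%N -> ~ (W = W' /\ i = j) ->
  sh i (w W) * sh j (w W') = 0.
Proof.
move=> Wl Wl' il jl' nWW; have cW := return_set_clopen cP cE Wl.
have cW' := return_set_clopen cP cE Wl'.
apply: lcfunP => x; rewrite lcfunM !lc_shift_chi // lcfun0 /indic.
have [Wx|Wx] := pselect (W (hpow T (- i%:Z) x));
  last by rewrite (memNset Wx) mul0r.
have [Wx'|Wx'] := pselect (W' (hpow T (- j%:Z) x));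
  last by rewrite (memNset Wx') mulr0.
by case: nWW; apply: tower_trivI Wl Wl' il jl' Wx Wx'.
Qed.

(** The levels [1], .., [i] of the tower lie outside [E], so the cut-offs by the
    complement of [E] act trivially. *)
Lemma mx_unit_pow_l l W (i : nat) : ret l W -> (i < l)%N ->
  (cr_C T (w (~` E)) * cr_t K T) ^+ i * cr_C T (w W) = cr_mono T i (sh i (w W)).
Proof.
move=> Wl; elim: i => [|i IH] il; first by rewrite expr0 mul1r lc_shift0.
rewrite exprS -mulrA IH; last exact: ltnW.
rewrite !cr_monoM rmorph1 mulr1 add0r lc_shift_comp -PoszD add1n.
rewrite (chi_mul_shift _ Wl) //; first exact: clopenC.
move=> y Wy; have [_ _ nE] := return_set_itinerary cP Wl Wy.
by apply: nE; rewrite il.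
Qed.

Lemma mx_unit_pow_r l W (j : nat) : ret l W -> (j < l)%N ->
  cr_C T (w W) * (cr_tV K T * cr_C T (w (~` E))) ^+ j =
    cr_mono T (- j%:Z) (w W).
Proof.
move=> Wl; elim: j => [|j IH] jl; first by rewrite expr0 mulr1 oppr0.
rewrite exprSr mulrA IH; last exact: ltnW.
rewrite !cr_monoM mul1r addr0 lc_shift_comp.
have -> : - j%:Z - 1 = - j.+1%:Z by lia.
congr (cr_mono _ _ _).
have -> : w W = sh (- j.+1%:Z) (sh j.+1 (w W)).
  by rewrite lc_shift_comp addNr lc_shift0.
rewrite -rmorphM mulrC (chi_mul_shift _ Wl) //; first exact: clopenC.
move=> y Wy; have [_ _ nE] := return_set_itinerary cP Wl Wy.
by apply: nE; rewrite jl.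
Qed.

(** The cut-offs are trivial on both sides, which leaves the indicator of level
    [i] times [t^(i - j)]. *)
Lemma mx_unitE l W (i j : nat) : ret l W -> (i < l)%N -> (j < l)%N ->
  e W i j = cr_mono T (i%:Z - j%:Z) (sh i (w W)).
Proof.
move=> Wl il jl; have cW := return_set_clopen cP cE Wl; rewrite /mx_unit.
have -> : cr_C T (w W) = cr_C T (w W) * cr_C T (w W).
  by rewrite cr_monoM lc_shift0 chi_idem.
rewrite mulrA (mx_unit_pow_l Wl il) -mulrA (mx_unit_pow_r Wl jl) cr_monoM.
by rewrite -rmorphM chi_idem.
Qed.

Lemma mx_unitM l W (i j p q : nat) : ret l W ->
  (i < l)%N -> (j < l)%N -> (p < l)%N -> (q < l)%N ->
  e W i j * e W p q = if j == p then e W i q else 0.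
Proof.
move=> Wl il jl pl ql; have cW := return_set_clopen cP cE Wl.
rewrite !(mx_unitE Wl) // cr_monoM.
have -> : sh i (w W) = sh (i%:Z - j%:Z) (sh j (w W)).
  by rewrite lc_shift_comp subrK.
rewrite -rmorphM; case: eqP => [<-|jp].
  by rewrite -rmorphM chi_idem // addrA subrK.
rewrite (tower_mul0 Wl Wl) // ?rmorph0; last by case.
by apply: crossedP => n /=; case: ifP.
Qed.

Lemma mx_unitM0 l l' W W' (i j p q : nat) : ret l W -> ret l' W' -> W <> W' ->
  (i < l)%N -> (j < l)%N -> (p < l')%N -> (q < l')%N ->
  e W i j * e W' p q = 0.
Proof.
move=> Wl Wl' WW' il jl pl ql.
rewrite (mx_unitE Wl) // (mx_unitE Wl') // cr_monoM.
have -> : sh i (w W) = sh (i%:Z - j%:Z) (sh j (w W)).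
  by rewrite lc_shift_comp subrK.
rewrite -rmorphM (tower_mul0 Wl Wl') // ?rmorph0; last by case.
by apply: crossedP => n /=; case: ifP.
Qed.

Lemma mx_unit00 W : e W 0 0 = cr_C T (w W).
Proof. by rewrite /mx_unit !expr0 mulr1 mul1r. Qed.

Section Star.
Variable conj : {rmorphism K -> K}.
Local Notation star := (@cr_star X K T conj).

Lemma cr_starD a b : star (a + b) = star a + star b.
Proof. by apply: crossedP => n; apply: lcfunP => x /=; rewrite rmorphD. Qed.

Lemma cr_star0 : star 0 = 0.
Proof. by apply: crossedP => n; apply: lcfunP => x /=; rewrite rmorph0. Qed.

Lemma cr_starZ c a : star (c *: a) = conj c *: star a.
Proof.
apply: crossedP => n; apply: lcfunP => x.
by rewrite [RHS]cr_scaleE /= cr_scaleE rmorphM.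
Qed.

Lemma mx_unit_star l W (i j : nat) : ret l W -> (i < l)%N -> (j < l)%N ->
  star (e W i j) = e W j i.
Proof.
move=> Wl il jl; have cW := return_set_clopen cP cE Wl;
  rewrite !(mx_unitE Wl) //.
apply: crossedP => n; apply: lcfunP => x /=.
have -> : (- n == i%:Z - j%:Z) = (n == j%:Z - i%:Z) by lia.
case: eqP => [->|_]; last by rewrite rmorph0.
rewrite [in RHS]lc_shift_chi // [X in conj X]lc_shift_chi //.
have -> : hpow T (- i%:Z) (hpow T (- (j%:Z - i%:Z)) x) = hpow T (- j%:Z) x.
  by rewrite -hpowD; congr (hpow _ _ _); lia.
by rewrite /indic; case: (_ \in _); rewrite ?rmorph1 ?rmorph0.
Qed.

End Star.

Section OneTower.
Variables (W : set X).
Local Notation l := (return_len T E P W).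
Hypothesis Wl : ret l W.
Local Notation h := (central_proj K T E P W).

Definition mxunits (M : 'M[K]_l) : crossed K T :=
  \sum_i \sum_j M i j *: e W i j.

Lemma mxunitsD M N : mxunits (M + N) = mxunits M + mxunits N.
Proof.
rewrite /mxunits -big_split; apply: eq_bigr => i _; rewrite -big_split /=.
by apply: eq_bigr => j _; rewrite mxE scalerDl.
Qed.

Lemma mxunitsZ c M : mxunits (c *: M) = c *: mxunits M.
Proof.
rewrite /mxunits scaler_sumr; apply: eq_bigr => i _; rewrite scaler_sumr.
by apply: eq_bigr => j _; rewrite mxE scalerA.
Qed.

Lemma mxunits1 : mxunits 1%:M = h.
Proof.
apply: eq_bigr => i _; rewrite (bigD1 i) //= big1 => [|j ji].
  by rewrite mxE eqxx scale1r addr0.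
by rewrite mxE eq_sym (negPf ji) scale0r.
Qed.

Lemma mxunitsM M N : mxunits M * mxunits N = mxunits (M *m N).
Proof.
rewrite /mxunits mulr_suml; apply: eq_bigr => i _; rewrite mulr_suml.
transitivity (\sum_j \sum_q (M i j * N j q) *: e W i q); last first.
  rewrite exchange_big; apply: eq_bigr => q _.
  by rewrite mxE scaler_suml.
apply: eq_bigr => j _.
rewrite mulr_sumr (bigD1 j) //= [X in _ + X]big1 ?addr0 => [|p pj].
  rewrite mulr_sumr; apply: eq_bigr => q _.
  by rewrite -scalerAl -scalerAr scalerA (mx_unitM Wl) // eqxx.
rewrite mulr_sumr big1 // => q _.
by rewrite -scalerAl -scalerAr (mx_unitM Wl) // val_eqE eq_sym (negPf pj)
  !scaler0.
Qed.

Lemma central_proj_idem : h * h = h.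
Proof. by rewrite -mxunits1 mxunitsM mulmx1. Qed.

Lemma mxunits_star conj M :
  cr_star conj (mxunits M) = mxunits (map_mx conj M^T).
Proof.
rewrite /mxunits (big_morph _ (cr_starD conj) (cr_star0 conj)) exchange_big.
rewrite (eq_bigr (fun i => \sum_j conj (M i j) *: e W j i)) => [|i _];
  last first.
  rewrite (big_morph _ (cr_starD conj) (cr_star0 conj)); apply: eq_bigr => j _.
  by rewrite cr_starZ (mx_unit_star _ Wl).
by apply: eq_bigr => i _; apply: eq_bigr => j _; rewrite !mxE.
Qed.

Lemma central_proj_star conj : cr_star conj h = h.
Proof.
rewrite -mxunits1 mxunits_star; congr mxunits; apply/matrixP => i j;
  rewrite !mxE eq_sym.
by case: eqP; rewrite ?rmorph1 ?rmorph0.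
Qed.

Lemma central_projE : h = \sum_(i < l) cr_C T (sh i (w W)).
Proof. by apply: eq_bigr => i _; rewrite (mx_unitE Wl) // subrr. Qed.

(** A level strictly inside the tower is contained in one piece of the
    partition; the base and the set above the top level lie in [E]. *)
Lemma chi_tower (Z : set X) (i : nat) : P Z -> (i <= l)%N ->
  (w Z * sh i (w W) = sh i (w W) /\ (0 < i < l)%N) \/ w Z * sh i (w W) = 0.
Proof.
have [_ [PE tP _] Pc] := cP; move=> PZ il; have cZ := Pc Z PZ.
have nEZ x : Z x -> ~ E x.
  by move=> Zx; change ((~` E) x); rewrite -PE; exists Z.
have [i0|i0] := eqVneq i 0%N.
  right; apply: chi_mul_shift0 Wl _ => // y Wy.
  by have [Ey _ _] := return_set_itinerary cP Wl Wy; rewrite i0 => /nEZ.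
have [iE|il'] := eqVneq i l.
  right; apply: chi_mul_shift0 Wl _ => // y Wy.
  by have [_ Ey _] := return_set_itinerary cP Wl Wy; rewrite iE => /nEZ.
have i0l : (0 < i < l)%N by lia.
have [_ _ [Zs ZsP WE]] := Wl.
have WZ y : W y -> Zs i (iter i T y) by rewrite WE => -[[_ H] _]; apply: H.
have [ZE|ZN] := pselect (Z = Zs i).
  by left; split=> //; apply: chi_mul_shift Wl _ => // y /WZ; rewrite ZE.
right; apply: chi_mul_shift0 Wl _ => // y /WZ Zsy Zy; apply: ZN.
by apply: tP => //; [exact: ZsP|exists (iter i T y)].
Qed.

(** Multiplying on the left keeps the levels [0], .., [l - 1] and on the right
    the levels [1], .., [l]; the two sums agree since levels [0] and [l]
    contribute nothing. *)
Lemma central_proj_comm_gen Z : P Z ->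
  h * (cr_C T (w Z) * cr_t K T) = (cr_C T (w Z) * cr_t K T) * h.
Proof.
move=> PZ; have ct : cr_C T (w Z) * cr_t K T = cr_mono T 1 (w Z).
  by rewrite cr_monoM rmorph1 mulr1.
rewrite ct central_projE mulr_suml mulr_sumr.
pose g (i : nat) := cr_mono T 1 (w Z * sh i (w W)).
have g0 i : (i == 0%N) || (i == l) -> g i = 0.
  move=> il; rewrite /g; case: (@chi_tower Z i) => // [|[_]|->]; [lia|lia|].
  by apply: crossedP => n /=; case: ifP.
transitivity (\sum_(i < l) g i).
  by apply: eq_bigr => i _; rewrite cr_monoM lc_shift0 mulrC.
transitivity (\sum_(i < l.+1) g i);
  first by rewrite big_ord_recr /= g0 ?eqxx ?orbT ?addr0.
rewrite big_ord_recl g0 // add0r; apply: eq_bigr => i _.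
by rewrite cr_monoM lc_shift_comp.
Qed.

(** As [h] is an idempotent commuting with the generator [a], [h a = h a h]; the
    terms [e_ii a e_jj] vanish except for [i = j + 1]. *)
Lemma central_proj_span_gen Z : P Z ->
  exists M, h * (cr_C T (w Z) * cr_t K T) = mxunits M.
Proof.
move=> PZ.
have -> : h * (cr_C T (w Z) * cr_t K T) = h * (cr_C T (w Z) * cr_t K T * h).
  by rewrite -central_proj_comm_gen // (mulrA h h) central_proj_idem.
have ct : cr_C T (w Z) * cr_t K T = cr_mono T 1 (w Z).
  by rewrite cr_monoM rmorph1 mulr1.
have cr_mono0 n : cr_mono T n 0 = 0 :> crossed K T.
  by apply: crossedP => m /=; case: ifP.
exists (\matrix_(i, j)
  if ((i : nat) == j.+1) && (w Z * sh i (w W) == sh i (w W)) then 1 else 0).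
rewrite ct central_projE mulr_suml; apply: eq_bigr => i _.
rewrite !mulr_sumr; apply: eq_bigr => j _; rewrite !mxE (mx_unitE Wl) //.
rewrite !cr_monoM add0r addr0 lc_shift0 lc_shift_comp -PoszD add1n.
have [ij|ij] /= := eqVneq (i : nat) j.+1.
  rewrite -ij; have -> : i%:Z - j%:Z = 1 by lia.
  case: (@chi_tower Z i) => // [|[-> _]|Z0]; first exact: ltnW.
    by rewrite eqxx scale1r -rmorphM chi_idem //; exact: return_set_clopen Wl.
  rewrite Z0 mulr0 cr_mono0; case: eqP => [<-|_]; last by rewrite scale0r.
  by rewrite cr_mono0 scaler0.
rewrite scale0r; have [jl|jl] := eqVneq j.+1 l.
  case: (@chi_tower Z j.+1) => // [[_]|->]; [by rewrite jl ltnn andbF|].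
  by rewrite mulr0 cr_mono0.
rewrite mulrCA (tower_mul0 Wl Wl) ?mulr0 ?cr_mono0 //; last first.
  by case=> _ /eqP; rewrite (negPf ij).
by rewrite ltn_neqAle jl ltn_ord.
Qed.

(** The elements that satisfy the conclusion form a unital *-subalgebra, and the
    generators belong to it. *)
Lemma central_proj_span conj a : partition_subalgebra conj P a ->
  h * a = a * h /\ exists M, h * a = mxunits M.
Proof.
move=> Ba.
apply: (Ba [set a | h * a = a * h /\ exists M, h * a = mxunits M]) => {a Ba}.
split; last first.
  move=> _ [Z PZ <-]; split; first exact: central_proj_comm_gen.
  exact: central_proj_span_gen.
split.
- by rewrite /= mulr1 mul1r; split=> //; exists 1%:M; rewrite mxunits1.
- move=> a b [ha [M hM]] [hb [N hN]] /=; rewrite mulrDr mulrDl ha hb;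
    split=> //.
  by exists (M + N); rewrite mxunitsD -hM -hN ha hb.
- move=> c a [ha [M hM]] /=; rewrite -scalerAr -scalerAl ha; split=> //.
  by exists (c *: M); rewrite mxunitsZ -hM ha.
- move=> a b [ha [M hM]] [hb [N hN]]; split;
    first by rewrite mulrA ha -mulrA hb mulrA.
  exists (M *m N); rewrite -mxunitsM -hM -hN [RHS]mulrA ha -(mulrA a h h).
  by rewrite central_proj_idem -ha -mulrA.
(* Taking adjoints turns [h a = a h] into the same relation for [a^*]. *)
- move=> a [ha [M hM]]; have sh := central_proj_star conj.
  have e1 : h * cr_star conj a = cr_star conj (a * h) by rewrite cr_starM sh.
  have e2 : cr_star conj a * h = cr_star conj (h * a) by rewrite cr_starM sh.
  by rewrite /mkset e1 e2 ha; split=> //; exists (map_mx conj M^T);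
    rewrite -mxunits_star -hM ha.
Qed.

Lemma pi_compE conj a : partition_subalgebra conj P a ->
  h * a = mxunits (pi_comp E P W a).
Proof.
move=> /central_proj_span[_ hM].
exact: (@xgetPex _ 0 [set M | h * a = mxunits M] hM).
Qed.

End OneTower.
End Towers.

(** * The Betti number as a sum over towers *)

Section RankFormula.
Variables (K : fieldType) (conj : {rmorphism K -> K}).
Variables (R : realType) (X : ptopologicalType) (T : homeo X).
Variable rk : forall m n : nat, 'M[crossed K T]_(m, n) -> R.
Hypothesis hrk : sylvester_rank_function rk.
Variables (E : set X) (P : set (set X)).
Hypotheses (cE : clopen E) (cP : clopen_partition P (~` E)).
Local Notation V := (return_sets T E P).
Local Notation len := (return_len T E P).
Local Notation h := (central_proj K T E P).
Local Notation rk1 a := (@rk 1%N 1%N a%:M).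
Local Notation m W := (rk1 (cr_C T (chi K W))).

Lemma return_set_len W : V W -> return_set T E P (len W) W.
Proof. by move=> [l Wl]; rewrite (return_lenE cP Wl). Qed.

Lemma rk_mxunits k W (A : 'M[crossed K T]_k)
    (M : 'I_k -> 'I_k -> 'M[K]_(len W)) :
  V W -> (forall a b, A a b = mxunits (M a b)) ->
  rk A = (\rank (\mxblock_(a < k, b < k) M a b))%:R * m W.
Proof.
move=> /return_set_len Wl AM; have [l0 _ _] := Wl.
rewrite -(@mx_unit00 X K T E W).
apply: (rk_mx_units hrk (e := fun i j : 'I_(len W) => mx_unit K T E W i j)
  (Ordinal l0)) => // i j p q.
by rewrite (mx_unitM K cE cP Wl).
Qed.

Lemma rk_central_proj W : V W -> rk1 (h W) = (len W)%:R * m W.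
Proof.
move=> VW; rewrite (@rk_mxunits 1 W _ (fun _ _ => 1%:M)) //; last first.
  by move=> a b; rewrite !ord1 mxE eqxx mulr1n mxunits1.
congr (_%:R * _).
set B := mxblock _; have -> : B = 1%:M.
  rewrite -mxdiagZ; apply/eq_mxblockP => a b.
  by rewrite !ord1 eqxx conform_mx_id.
by rewrite mxrank1 big_ord1.
Qed.

Definition central_projs (F : seq (set X)) : crossed K T := \sum_(W <- F) h W.

Lemma central_proj_orth W W' : V W -> V W' -> W <> W' -> h W * h W' = 0.
Proof.
move=> /return_set_len Wl /return_set_len Wl' WW'.
rewrite mulr_suml big1 // => i _; rewrite mulr_sumr big1 // => j _.
exact: (mx_unitM0 K cE cP Wl Wl').
Qed.

Lemma central_projs_orth W F : V W -> (forall W', W' \in F -> V W') ->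
  W \notin F -> h W * central_projs F = 0 /\ central_projs F * h W = 0.
Proof.
move=> VW VF WF; rewrite mulr_sumr mulr_suml; split.
  rewrite big_seq big1 // => W' W'F; apply: central_proj_orth => //;
    first exact: VF.
  by move=> WE; rewrite WE W'F in WF.
rewrite big_seq big1 // => W' W'F; apply: central_proj_orth => //;
  first exact: VF.
by move=> WE; rewrite -WE W'F in WF.
Qed.

Lemma central_projs_idem F : uniq F -> (forall W, W \in F -> V W) ->
  central_projs F * central_projs F = central_projs F.
Proof.
elim: F => [|W F IH] /=; first by rewrite /central_projs big_nil mulr0.
move=> /andP[WF uF] VF; have VW : V W by apply: VF; rewrite mem_head.
have VF' W' : W' \in F -> V W' by move=> W'F; apply: VF; rewrite inE W'F orbT.
have [hF0 Fh0] := central_projs_orth VW VF' WF.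
rewrite {1 2 3}/central_projs big_cons -/(central_projs F).
rewrite mulrDl !mulrDr hF0 Fh0 IH // addr0 add0r.
by rewrite (central_proj_idem K cE cP (return_set_len VW)).
Qed.

Lemma rk_central_projs k (A : 'M[crossed K T]_k) F :
  uniq F -> (forall W, W \in F -> V W) ->
  (forall W, W \in F -> (h W)%:M *m A = A *m (h W)%:M) ->
  rk ((central_projs F)%:M *m A) = \sum_(W <- F) rk ((h W)%:M *m A).
Proof.
elim: F => [|W F IH] /=.
  by rewrite /central_projs !big_nil raddf0 mul0mx sylv0.
move=> /andP[WF uF] VF cF; have VW : V W by apply: VF; rewrite mem_head.
have VF' W' : W' \in F -> V W' by move=> W'F; apply: VF; rewrite inE W'F orbT.
have cF' W' : W' \in F -> (h W')%:M *m A = A *m (h W')%:M.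
  by move=> W'F; apply: cF; rewrite inE W'F orbT.
have cW : (h W)%:M *m A = A *m (h W)%:M by apply: cF; rewrite mem_head.
have [hF0 Fh0] := central_projs_orth VW VF' WF.
have cFA : (central_projs F)%:M *m A = A *m (central_projs F)%:M.
  rewrite /central_projs raddf_sum mulmx_suml mulmx_sumr big_seq [RHS]big_seq.
  by apply: eq_bigr => W' /cF'.
rewrite big_cons -IH // {1}/central_projs big_cons -/(central_projs F).
rewrite raddfD mulmxDl.
rewrite (rk_orth hrk (P := (h W)%:M) (Q := (central_projs F)%:M)) //.
- by rewrite -scalar_mxM hF0 raddf0.
- by rewrite -scalar_mxM Fh0 raddf0.
- rewrite -!mulmxA -cW !mulmxA -!scalar_mxM.
  by rewrite !(central_proj_idem K cE cP (return_set_len VW)).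
- by rewrite -!mulmxA -cFA !mulmxA -!scalar_mxM !central_projs_idem.
Qed.

Variables (k : nat) (A : 'M[crossed K T]_k).
Hypothesis AB : forall i j, partition_subalgebra conj P (A i j).

Lemma rk_central_proj_mul W : V W ->
  rk ((h W)%:M *m A) = (\rank (pi_comp_mx E P W A))%:R * m W.
Proof.
move=> VW; apply: rk_mxunits => // a b.
rewrite mul_scalar_mx mxE.
exact (pi_compE cE cP (return_set_len VW) (AB a b)).
Qed.

Lemma central_proj_comm W : V W -> (h W)%:M *m A = A *m (h W)%:M.
Proof.
move=> VW; apply/matrixP => i j; rewrite mul_scalar_mx mxE.
have [-> _] := central_proj_span cE cP (return_set_len VW) (AB i j).
rewrite mxE (bigD1 j) //= big1 ?addr0 => [|s sj].
  by rewrite mxE eqxx.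
by rewrite mxE (negPf sj) mulr0.
Qed.

Definition betti_sum (F : seq (set X)) : R :=
  \sum_(W <- F) m W * (dim_ker (pi_comp_mx E P W A))%:R.

(** The partial sum equals [k rk(h_F) - rk(h_F A)], which differs from
    [k - rk A] by [k (1 - rk h_F)] minus the rank lost when [A] is cut by
    [h_F]. *)
Lemma betti_sum_bounds F : uniq F -> (forall W, W \in F -> V W) ->
  0 <= betti rk A - betti_sum F <=
    k%:R * (1 - \sum_(W <- F) m W * (len W)%:R).
Proof.
move=> uF VF.
have ee := central_projs_idem uF VF.
have rE : rk1 (central_projs F) = \sum_(W <- F) m W * (len W)%:R.
  rewrite -[_%:M]mulmx1 rk_central_projs //; last first.
    by move=> W _; rewrite mulmx1 mul1mx.
  rewrite big_seq [RHS]big_seq; apply: eq_bigr => W WF.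
  rewrite mulmx1 rk_central_proj; last exact: VF.
  exact: mulrC.
have rA : rk ((central_projs F)%:M *m A) =
    \sum_(W <- F) (\rank (pi_comp_mx E P W A))%:R * m W.
  rewrite rk_central_projs //; last by move=> W /VF /central_proj_comm.
  rewrite big_seq [RHS]big_seq; apply: eq_bigr => W /VF.
  exact: rk_central_proj_mul.
have SE : betti_sum F =
    k%:R * rk1 (central_projs F) - rk ((central_projs F)%:M *m A).
  rewrite rE rA mulr_sumr -sumrB; apply: eq_bigr => W _.
  have sizeE : (\sum_(i < k) len W)%:R = k%:R * (len W)%:R :> R.
    by rewrite sum_nat_const card_ord natrM.
  rewrite dim_kerE natrB ?rank_leq_row // sizeE mulrBr mulrCA.
  by congr (_ - _); exact: mulrC.
have := rk_compress_ge hrk A ee.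
have := rk_mul_ler hrk (central_projs F)%:M A.
by rewrite SE /betti -rE; lra.
Qed.

End RankFormula.

Theorem proposition3p4 (K : fieldType) (conj : {rmorphism K -> K})
    (hconj : pos_def_involution conj)
    (R : realType) (X : ptopologicalType)
    (Xinf : infinite_set [set: X]) (Xtd : totally_disconnected [set: X])
    (Xcpt : compact [set: X]) (Xmet : metrizable R X)
    (T : homeo X) (mu : probability (borelType X) R)
    (mu_inv : invariant_measure mu T) (mu_erg : ergodic mu T)
    (mu_full : full_measure mu)
    (rk : forall m n : nat, 'M[crossed K T]_(m, n) -> R)
    (hrk : crossed_rank mu rk)
    (E : set X) (E0 : E !=set0) (Eclopen : clopen E)
    (P : set (set X)) (hP : clopen_partition P (~` E))
    (k : nat) (k1 : (1 <= k)%N) (A : 'M[crossed K T]_k)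
    (AB : forall i j, partition_subalgebra conj P (A i j)) :
  (betti rk A)%:E =
    \esum_(W in return_sets T E P)
      (mu W * (dim_ker (pi_comp_mx E P W A))%:R%:E)%E.
Proof.
have [sylv rk_chi] := hrk.
have muE W : return_sets T E P W ->
    mu W = (rk 1%N 1%N (cr_C T (chi K W))%:M)%:E.
  by move=> [l Wl]; rewrite rk_chi //;
    exact: return_set_clopen hP _ _ Eclopen Wl.
have fsE F (f : set X -> nat) : finite_set F -> F `<=` return_sets T E P ->
    (\sum_(W \in F) mu W * (f W)%:R%:E)%E =
    (\sum_(W <- fset_set F) rk 1%N 1%N (cr_C T (chi K W))%:M * (f W)%:R)%:E.
  move=> fF FV; rewrite fsbig_finite //= -sumEFin big_seq [RHS]big_seq.
  apply: eq_bigr => W; rewrite in_fset_set // inE => /FV /muE ->.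
  by rewrite EFinM.
have VF F : finite_set F -> F `<=` return_sets T E P ->
    forall W, W \in enum_fset (fset_set F) -> return_sets T E P W.
  by move=> fF FV W; rewrite in_fset_set // inE => /FV.
have bnd F (fF : finite_set F) (FV : F `<=` return_sets T E P) :=
  betti_sum_bounds sylv Eclopen hP AB (fset_uniq (fset_set F)) (VF F fF FV).
apply/eqP; rewrite eq_le; apply/andP; split; last first.
  apply: ub_ereal_sup => _ [F [fF FV] <-]; rewrite fsE // lee_fin.
  by have /andP[+ _] := bnd F fF FV; rewrite subr_ge0.
(* Towers of total mass [1 - eps / k] leave a defect of at most [eps]. *)
apply/lee_addgt0Pr => eps eps0.
have k0 : 0 < k%:R :> R by rewrite ltr0n.
have [|F [fF FV le1]] := @towers_exhaust X R mu T E P mu_inv mu_erg mu_full E0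
  Eclopen hP (eps / k%:R).
  exact: divr_gt0.
apply: (@le_trans _ _ ((\sum_(W \in F) mu W *
    (dim_ker (pi_comp_mx E P W A))%:R%:E) + eps%:E)%E); last first.
  by apply: leeD => //; apply: esum_ge; exists F.
rewrite fsE // -EFinD lee_fin -lerBlDl.
have /andP[_ /le_trans -> //] := bnd F fF FV.
rewrite fsE // lee_fin in le1.
rewrite mulrC -ler_pdivlMr //; lra.
Qed.
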